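(* Let $\mathcal{O}$ be the Lie-Jordan algebra of observables of a finite-dimensional quantum system, and let $\Lambda$, $R$ be the canonical skew-symmetric and symmetric $(2,0)$-tensor fields on $\mathcal{O}^*$. Put $\widehat{\Lambda}(\zeta) = f_I(\zeta)\Lambda(\zeta)$ and $\widehat{R}(\zeta) = f_I(\zeta) R(\zeta)$ for $\zeta\in\mathcal{P}_0$. Then the restrictions of $\widehat{\Lambda}$ and $\widehat{R}$ to the set of states $\mathcal{D}$ are a pair of tensor fields $\Lambda_{\mathcal{D}}$ and $R_{\mathcal{D}}$ on $\mathcal{D}$ whose actions on expectation value functions are given by $$\Lambda_{\mathcal{D}}(\mathrm{d}e_a,\mathrm{d}e_b)(\rho) = e_{[[a,b]]}(\rho),\qquad R_{\mathcal{D}}(\mathrm{d}e_a,\mathrm{d}e_b)(\rho) = e_{a\odot b}(\rho) - e_a(\rho)e_b(\rho),$$ for any $\rho\in\mathcal{D}$ and any $a,b\in\mathcal{O}$.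
   Context: $\mathcal{A}$ is a finite-dimensional unital C*-algebra with unit $I$, and $\mathcal{O}=\{a\in\mathcal{A}: a^*=a\}$ is the real vector space of its real elements (observables), with products $[[a,b]] = -\frac{i}{2}(ab-ba)$ (Lie) and $a\odot b=\frac12(ab+ba)$ (Jordan). $\mathcal{O}^*$ is the real dual space. For $a\in\mathcal{O}$, $f_a:\mathcal{O}^*\to\mathbb{R}$ is $f_a(\xi)=\xi(a)$. Identifying $T^*_\xi\mathcal{O}^*$ with $\mathcal{O}$ (so $\mathrm{d}f_a$ corresponds to $a$), the tensor fields are defined by $\Lambda(\xi)(a,b)=\xi([[a,b]])$ and $R(\xi)(a,b)=\xi(a\odot b)$. $\mathcal{P}\subset\mathcal{O}^*$ is the cone of positive functionals ($\xi(a^2)\ge 0$ for all $a\in\mathcal{O}$), $\mathcal{P}_0=\mathcal{P}\setminus\{0\}$, and the set of states is $\mathcal{D}=\{\rho\in\mathcal{P}:\rho(I)=1\}$. The expectation value function of $a\in\mathcal{O}$ is $e_a=f_a/f_I$, defined where $f_I\neq0$; its restriction to $\mathcal{D}$ is also denoted $e_a$. Differential calculus on $\mathcal{D}$ is inherited from $\mathcal{O}^*$. $\mathcal{D}$ is regarded both as the subset $f_I=1$ of $\mathcal{P}$ and as the quotient of $\mathcal{P}_0$ by positive dilations, with projection $\pi(\zeta)=\zeta/f_I(\zeta)$. The ''restriction to $\mathcal{D}$'' of a dilation-invariant contravariant tensor field is its evaluation, at points $\rho\in\mathcal{D}$, on the dilation-invariant differentials $\mathrm{d}e_a$, $a\in\mathcal{O}$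 (computed in $\mathcal{O}^*$). These differentials annihilate the radial direction, and they span the cotangent space at $\rho$ of the affine hyperplane $\{f_I=1\}$ containing $\mathcal{D}$. *)

(* Defs.v *)
From HB Require Import structures.
From mathcomp Require Import all_boot all_order all_algebra all_field.
From mathcomp Require Import complex.
From mathcomp Require Import all_classical all_reals all_analysis.

Set Implicit Arguments.
Unset Strict Implicit.
Unset Printing Implicit Defensive.

Import Order.TTheory GRing.Theory Num.Theory.
Import numFieldNormedType.Exports VectorInternalTheory.

Local Open Scope classical_set_scope.
Local Open Scope complex_scope.
Local Open Scope ring_scope.

(* Finite-dimensional unital C*-algebras.  Finite dimension is part of
   [Falgebra] (which also imposes 1 != 0) and makes completeness automatic.
   The C*-norm is a field of the mixin because the library has no join of its
   normed modules with unital rings. *)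
HB.mixin Record isCstar (R : realType) A & Falgebra R[i] A := {
  star : A -> A;
  starD : forall a b : A, star (a + b) = star a + star b;
  starZ : forall (z : R[i]) (a : A), star (z *: a) = (z^*)%C *: star a;
  starM : forall a b : A, star (a * b) = star b * star a;
  starK : forall a : A, star (star a) = a;
  cnorm : A -> R;
  cnormD : forall a b : A, cnorm (a + b) <= cnorm a + cnorm b;
  cnormZ : forall (z : R[i]) (a : A), cnorm (z *: a) = Normc.normc z * cnorm a;
  cnorm0_eq0 : forall a : A, cnorm a = 0 -> a = 0;
  cnormM : forall a b : A, cnorm (a * b) <= cnorm a * cnorm b;
  cnorm_star : forall a : A, cnorm (star a * a) = cnorm a ^+ 2
}.

#[short(type="cstarAlgType")]
HB.structure Definition CstarAlg (R : realType) :=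
  {A of Falgebra R[i] A & isCstar R A}.

(* A as a real vector space. *)
Definition realified (R : realType) (A : cstarAlgType R) : Type := A.

Section Realified.
Variables (R : realType) (A : cstarAlgType R).
Local Notation AR := (realified A).

HB.instance Definition _ := GRing.Zmodule.copy AR A.

Definition scaleR (r : R) (a : AR) : AR := r%:C *: (a : A).

Fact scaleRA (r s : R) (a : AR) : scaleR r (scaleR s a) = scaleR (r * s) a.
Proof. by rewrite /scaleR scalerA rmorphM. Qed.
Fact scaleR1 : left_id 1 scaleR.
Proof. by move=> a; rewrite /scaleR rmorph1 scale1r. Qed.
Fact scaleRDr : right_distributive scaleR +%R.
Proof. by move=> r a b; rewrite /scaleR scalerDr. Qed.
Fact scaleRDl (a : AR) : {morph scaleR^~ a : r s / r + s}.
Proof. by move=> r s; rewrite /scaleR rmorphD scalerDl. Qed.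

HB.instance Definition _ := GRing.Zmodule_isLmodule.Build R AR
  scaleRA scaleR1 scaleRDr scaleRDl.

Let n := dim A.
Definition real_coord (a : AR) : 'rV[R]_(n + n) :=
  row_mx (map_mx (@complex.Re R) (v2r (a : A)))
         (map_mx (@complex.Im R) (v2r (a : A))).
Definition of_real_coord (v : 'rV[R]_(n + n)) : AR :=
  @r2v _ A (\row_j (lsubmx v 0 j +i* rsubmx v 0 j)).

Fact real_coord_linear : linear real_coord.
Proof.
move=> r a b; rewrite /real_coord.
have -> : v2r (r *: a + b : A) = r%:C *: v2r (a : A) + v2r (b : A).
  by rewrite -linearP.
rewrite scale_row_mx add_row_mx; congr row_mx;
  apply/rowP=> j; rewrite !mxE.
  by case: (v2r (a : A) 0 j) (v2r (b : A) 0 j) => [x y] [z t] /=;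
    rewrite mul0r subr0.
by case: (v2r (a : A) 0 j) (v2r (b : A) 0 j) => [x y] [z t] /=;
  rewrite mul0r addr0.
Qed.

Fact real_coord_bij : bijective real_coord.
Proof.
exists of_real_coord => [a|v]; rewrite /real_coord /of_real_coord.
  rewrite row_mxKl row_mxKr -[RHS](@v2rK _ A); congr r2v.
  by apply/rowP=> j; rewrite !mxE; case: (v2r (a : A) 0 j).
rewrite r2vK -[RHS]hsubmxK; congr row_mx;
  by apply/rowP=> j; rewrite !mxE.
Qed.

HB.instance Definition _ := Lmodule_hasFinDim.Build R AR
  (exist2 _ _ real_coord real_coord_linear real_coord_bij).

End Realified.

Section Observables.
Variables (R : realType) (A : cstarAlgType R).
Local Notation AR := (realified A).

Definition starR (a : AR) : AR := star (a : A).

Fact starR_linear : linear starR.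
Proof.
move=> r a b; rewrite /starR.
transitivity (star (r%:C *: (a : A)) + star (b : A)); first exact: starD.
by rewrite starZ conjc_real.
Qed.

HB.instance Definition _ := GRing.isLinear.Build R AR AR *:%R starR starR_linear.

Definition selfadjoint : {vspace AR} := fixedSpace (linfun starR).

Lemma selfadjointP (a : AR) : reflect (star (a : A) = a) (a \in selfadjoint).
Proof. by apply: (iffP fixedSpaceP); rewrite lfunE. Qed.

Definition obs : vectType R := subvs_of selfadjoint.

Definition obs_val (a : obs) : A := vsval a.

Lemma star_obs (a : obs) : star (obs_val a) = obs_val a.
Proof. exact/selfadjointP/subvsP. Qed.

Lemma starN (a : A) : star (- a) = - star a.
Proof. by rewrite -scaleN1r starZ rmorphN1 scaleN1r. Qed.

Fact one_subproof : (1 : A) \in selfadjoint.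
Proof.
by apply/selfadjointP; rewrite -[LHS]mul1r -[X in X * _]starK -starM mul1r starK.
Qed.

Fact sqr_subproof (a : obs) : obs_val a * obs_val a \in selfadjoint.
Proof. by apply/selfadjointP; rewrite starM !star_obs. Qed.

Fact lie_subproof (a b : obs) :
  - ('i%C / 2 : R[i]) *: (obs_val a * obs_val b - obs_val b * obs_val a)
    \in selfadjoint.
Proof.
apply/selfadjointP; rewrite starZ starD starN !starM !star_obs.
have -> : conjc (- ('i%C / 2)) = 'i%C / 2 :> R[i].
  rewrite rmorphN rmorphM fmorphV rmorph_nat.
  rewrite [X in - (X / _)](_ : _ = - 'i%C) ?mulNr ?opprK //.
  by apply/eqP; rewrite eq_complex /= oppr0 !eqxx.
by rewrite scaleNr -scalerN opprB.
Qed.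

Fact jordan_subproof (a b : obs) :
  (2^-1 : R[i]) *: (obs_val a * obs_val b + obs_val b * obs_val a)
    \in selfadjoint.
Proof.
apply/selfadjointP; rewrite starZ starD !starM !star_obs.
by rewrite fmorphV rmorph_nat addrC.
Qed.

Definition obs_one : obs := Subvs one_subproof.
Definition obs_sqr (a : obs) : obs := Subvs (sqr_subproof a).
Definition lie (a b : obs) : obs := Subvs (lie_subproof a b).
Definition jordan (a b : obs) : obs := Subvs (jordan_subproof a b).

End Observables.

(* Any norm on a finite-dimensional space gives the same topology and the same
   differential; this one is the sup norm of coordinates. *)
Section NormHom.
Variables (R : realType) (U V : vectType R).

Definition hom_norm (f : 'Hom(U, V)) : R := `|v2r f|.

Fact hom_normD f g : hom_norm (f + g) <= hom_norm f + hom_norm g.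
Proof. by rewrite /hom_norm linearD ler_normD. Qed.
Fact hom_normZ (r : R) f : hom_norm (r *: f) = `|r| * hom_norm f.
Proof. by rewrite /hom_norm linearZ normrZ. Qed.
Fact hom_norm0_eq0 f : hom_norm f = 0 -> f = 0.
Proof. by move/normr0_eq0 => f0; apply: (@v2r_inj _ 'Hom(U, V)); rewrite f0 linear0. Qed.

HB.instance Definition _ := Lmodule_isNormed.Build R 'Hom(U, V)
  hom_normD hom_normZ hom_norm0_eq0.

End NormHom.

Section Smooth.
Variables (R : realType) (V : normedModType R).

Fixpoint differentiable_n (k : nat) (U : set V) (f : V -> R) : Prop :=
  if k is k'.+1 then
    {in U, forall x, differentiable f x} /\
    forall v : V, differentiable_n k' U ('D_v f)
  else {in U, continuous f}.

(* Smoothness of f on an open set U. *)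
Definition smooth_on (U : set V) (f : V -> R) : Prop :=
  forall k, differentiable_n k U f.

End Smooth.

Section DualSpace.
Variables (R : realType) (A : cstarAlgType R).
Local Notation Odual := 'Hom(obs A, R^o).

Definition lin_fun (a : obs A) (xi : Odual) : R := xi a.

HB.instance Definition _ (a : obs A) := GRing.isLinear.Build R Odual R^o *:%R
  (lin_fun a : Odual -> R^o)
  (fun r xi eta => etrans (add_lfunE _ _ _)
                     (congr1 (+%R^~ (eta a)) (scale_lfunE _ _ _))).

Definition expval (a : obs A) (xi : Odual) : R :=
  lin_fun a xi / lin_fun (obs_one A) xi.

Definition positive : set Odual := [set xi | forall a, 0 <= xi (obs_sqr a)].
Definition positive0 : set Odual := positive `\ 0.
Definition states : set Odual := [set rho | positive rho /\ rho (obs_one A) = 1].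

(* T*_xi O^*, and the differential as an element of it. *)
Definition cotangent : vectType R := 'Hom(Odual, R^o).
Definition differential (f : Odual -> R) (xi : Odual) : cotangent :=
  linfun ('d f xi : Odual -> R^o).

Definition lin_cov (a : obs A) : cotangent := linfun (lin_fun a : Odual -> R^o).

Fact lin_cov_linear : linear lin_cov.
Proof.
move=> r a b; apply/lfunP => xi.
by rewrite add_lfunE scale_lfunE !lfunE /= /lin_fun linearP.
Qed.
HB.instance Definition _ := GRing.isLinear.Build R (obs A) cotangent *:%R
  lin_cov lin_cov_linear.

(* The identification of O with T*_xi O^*: a is sent to the differential of the
   linear function f_a, which is f_a itself at every xi. *)
Definition cov_of_obs : 'Hom(obs A, cotangent) := linfun lin_cov.

Lemma cov_of_obsE a xi : cov_of_obs a xi = xi a.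
Proof. by rewrite !lfunE. Qed.

(* The inverse of [cov_of_obs], which is bijective by reflexivity of the
   finite-dimensional space O. *)
Definition obs_of_cov (alpha : cotangent) : obs A := (cov_of_obs^-1)%VF alpha.

Lemma lker_cov_of_obs : lker cov_of_obs = 0%VS.
Proof.
apply/eqP/lker0P => a b eab; apply: (@v2r_inj _ (obs A)); apply/rowP => j.
have lin : linear (fun c : obs A => v2r c 0 j : R^o).
  by move=> r c d; rewrite linearP !mxE.
pose L := GRing.isLinear.Build R (obs A) R^o *:%R _ lin.
pose l : {linear obs A -> R^o} := HB.pack (fun c : obs A => v2r c 0 j : R^o) L.
have /lfunP/(_ (linfun l)) := eab.
by rewrite !cov_of_obsE !lfunE.
Qed.

Lemma cov_of_obsK : cancel cov_of_obs obs_of_cov.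
Proof. by apply: lker0_lfunK; rewrite lker_cov_of_obs. Qed.

Lemma obs_of_covK : cancel obs_of_cov cov_of_obs.
Proof.
move=> alpha; apply: limg_lfunVK; suff -> : limg cov_of_obs = fullv by rewrite memvf.
apply/eqP; rewrite eqEdim subvf /= limg_dim_eq ?lker_cov_of_obs ?capv0 //.
by rewrite !dimvf -[dim cotangent]/(dim (obs A) * 1 * 1)%N !muln1.
Qed.

Definition Lambda (xi : Odual) (alpha beta : cotangent) : R :=
  xi (lie (obs_of_cov alpha) (obs_of_cov beta)).
Definition Rtensor (xi : Odual) (alpha beta : cotangent) : R :=
  xi (jordan (obs_of_cov alpha) (obs_of_cov beta)).

Definition Lambda_hat (zeta : Odual) (alpha beta : cotangent) : R :=
  lin_fun (obs_one A) zeta * Lambda zeta alpha beta.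
Definition Rtensor_hat (zeta : Odual) (alpha beta : cotangent) : R :=
  lin_fun (obs_one A) zeta * Rtensor zeta alpha beta.

(* Invariance of a contravariant 2-tensor field on P_0 under the dilations
   zeta |-> s *: zeta with s > 0; covectors are pulled back along the
   differential of the dilation, which is s times the identity. *)
Definition dilation_invariant (T : Odual -> cotangent -> cotangent -> R) :=
  forall (s : R) (zeta : Odual) (alpha beta : cotangent),
    0 < s -> positive0 zeta ->
    T (s *: zeta) alpha beta =
    T zeta (alpha \o (s *: \1))%VF (beta \o (s *: \1))%VF.

(* The tangent space of the hyperplane f_I = 1 at any of its points. *)
Definition hyperplane_tangent : {vspace Odual} := lker (cov_of_obs (obs_one A)).
Definition states_cotangent : vectType R :=
  'Hom(subvs_of hyperplane_tangent, R^o).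

(* The differential at rho of the restriction of f to D. *)
Definition states_differential (f : Odual -> R) (rho : states) :
    states_cotangent :=
  linfun (fun v : subvs_of hyperplane_tangent => differential f (val rho) (vsval v)).

Definition smooth_on_states (phi : states -> R) : Prop :=
  exists (U : set Odual) (g : Odual -> R),
    [/\ open U, states `<=` U, smooth_on U g & forall rho, phi rho = g (val rho)].

(* Contravariant 2-tensor fields on D.  All the cotangent spaces of the
   hyperplane are the same space, so smoothness is tested on constant
   covectors. *)
Definition tensor_field_on_states
    (T : states -> states_cotangent -> states_cotangent -> R) : Prop :=
  [/\ forall rho alpha, scalar (T rho alpha),
      forall rho beta, scalar (T rho ^~ beta) &
      forall alpha beta, smooth_on_states (fun rho => T rho alpha beta)].

(* TD is the restriction to D of the dilation-invariant tensor field T, i.e. the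
   evaluation of T at points of D on the differentials of the e_a. *)
Definition restricts_to_states (T : Odual -> cotangent -> cotangent -> R)
    (TD : states -> states_cotangent -> states_cotangent -> R) : Prop :=
  tensor_field_on_states TD /\
  forall (rho : states) (a b : obs A),
    TD rho (states_differential (expval a) rho)
           (states_differential (expval b) rho) =
    T (val rho) (differential (expval a) (val rho))
                (differential (expval b) (val rho)).

End DualSpace.

Arguments positive {R} A _.
Arguments positive0 {R} A _.
Arguments states {R} A _.
Arguments cotangent {R} A.
Arguments states_cotangent {R} A.

(* Main.v *)
(* At a state [rho] the covector [d e_a] corresponds to the observable
   [a - rho(a) I].  If a bilinear product [p] on [O] satisfies
   [p I a = p a I = c a], then evaluating [rho] on the product of two such
   centred observables gives [rho (p a b) - c rho(a) rho(b)]; the Lie product has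
   [c = 0] and the Jordan product [c = 1].  Every covector on the hyperplane is
   the differential of some [e_a], which gives uniqueness; a linear choice of
   [a] turns the formula into a tensor field that is polynomial in [rho]. *)

Require Import Defs.
From HB Require Import structures.
From mathcomp Require Import all_boot all_order all_algebra all_field.
From mathcomp Require Import complex.
From mathcomp Require Import all_classical all_reals all_analysis.
From mathcomp Require Import ring.

Set Implicit Arguments.
Unset Strict Implicit.
Unset Printing Implicit Defensive.

Import Order.TTheory GRing.Theory Num.Theory.
Import numFieldNormedType.Exports VectorInternalTheory.

Local Open Scope ring_scope.

(** * Bilinearity and unit laws of the Lie and Jordan products *)

Section ObservableProducts.
Variables (R : realType) (A : cstarAlgType R).
Implicit Types a b c : obs A.

Lemma obs_val_inj : injective (@obs_val R A).
Proof. exact: val_inj. Qed.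

(** With [obs_val_inj], this moves identities between observables into [A], where real scalars act
    through their embedding in the complex numbers. *)
Lemma obs_valP (r : R) a b :
  obs_val (r *: a + b) = r%:C%C *: obs_val a + obs_val b.
Proof. by rewrite /obs_val linearP. Qed.

Lemma obs_val_lie a b : obs_val (lie a b) =
  - ('i%C / 2) *: (obs_val a * obs_val b - obs_val b * obs_val a).
Proof. by []. Qed.

Lemma obs_val_jordan a b : obs_val (jordan a b) =
  2^-1 *: (obs_val a * obs_val b + obs_val b * obs_val a).
Proof. by []. Qed.

Lemma lie_linearl b : linear (@lie R A ^~ b).
Proof.
move=> r a c; apply: obs_val_inj; rewrite obs_valP !obs_val_lie obs_valP.
rewrite scalerA [X in _ = X *: _ + _]mulrC -scalerA -scalerDr; congr (_ *: _).
by rewrite mulrDl mulrDr -scalerAl -scalerAr scalerBr opprD addrACA.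
Qed.

Lemma lieC a b : lie a b = - lie b a.
Proof.
apply: obs_val_inj; rewrite -[RHS]/(- obs_val (lie b a)) !obs_val_lie.
by rewrite -scalerN opprB.
Qed.

Lemma lie_linearr a : linear (@lie R A a).
Proof.
by move=> r b c; rewrite ![lie a _]lieC lie_linearl opprD scalerN.
Qed.

Lemma lie1 b : lie (obs_one A) b = 0.
Proof.
apply: obs_val_inj; rewrite obs_val_lie -[obs_val (obs_one A)]/1.
by rewrite mul1r mulr1 subrr scaler0.
Qed.

Lemma jordan_linearl b : linear (@jordan R A ^~ b).
Proof.
move=> r a c; apply: obs_val_inj; rewrite obs_valP !obs_val_jordan obs_valP.
rewrite scalerA [X in _ = X *: _ + _]mulrC -scalerA -scalerDr; congr (_ *: _).
by rewrite mulrDl mulrDr -scalerAl -scalerAr scalerDr addrACA.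
Qed.

Lemma jordanC a b : jordan a b = jordan b a.
Proof. by apply: obs_val_inj; rewrite !obs_val_jordan addrC. Qed.

Lemma jordan_linearr a : linear (@jordan R A a).
Proof. by move=> r b c; rewrite ![jordan a _]jordanC jordan_linearl. Qed.

Lemma jordan1 b : jordan (obs_one A) b = b.
Proof.
apply: obs_val_inj; rewrite obs_val_jordan -[obs_val (obs_one A)]/1.
rewrite mul1r mulr1 -mulr2n -(scaler_nat 2 (obs_val b)) scalerA.
by rewrite mulVf ?scale1r ?pnatr_eq0.
Qed.

End ObservableProducts.

(** * Differentials and smoothness of functions on the dual space *)

Section Calculus.
Variables (R : realType) (A : cstarAlgType R).
Local Notation Odual := 'Hom(obs A, R^o).

(** Expand [v] in the standard basis: each coordinate is at most the sup norm, so the sum of the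
    absolute values of [f] on the basis serves as [C]. *)
Lemma bounded_coord_linear (n : nat) (f : {linear 'rV[R]_n -> R^o}) :
  exists2 C : R, 0 <= C & forall v, `|f v| <= C * `|v|.
Proof.
exists (\sum_j `|f (delta_mx 0 j)|); first exact: sumr_ge0.
move=> v; rewrite [in f v](row_sum_delta v) linear_sum mulr_suml.
apply: (le_trans (ler_norm_sum _ _ _)); apply: ler_sum => j _.
rewrite linearZ normrZ mulrC ler_wpM2l //.
rewrite [leRHS]mx_normrE.
exact: (le_bigmax _ (fun ij => `|v ij.1 ij.2|) (0, j)).
Qed.

(** The norm on the dual is the sup norm of [v2r], so the bound in coordinates is a bound for
    [lin_fun a]. *)
Lemma continuous_lin_fun (a : obs A) : continuous (lin_fun a : Odual -> R^o).
Proof.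
have lin : linear (fun v => lin_fun a (r2v v : Odual) : R^o).
  by move=> r u v; rewrite linearP linearP.
pose L := GRing.isLinear.Build R _ R^o *:%R _ lin.
pose l : {linear 'rV[R]_(dim Odual) -> R^o} :=
  HB.pack (fun v => lin_fun a (r2v v : Odual) : R^o) L.
have [C C0 lC] := bounded_coord_linear l.
apply: (@bounded_linear_continuous R Odual R^o (lin_fun a)).
apply/linear_boundedP.
near=> M => xi; have := lC (v2r xi); rewrite /l /= v2rK => /le_trans; apply.
by apply: ler_wpM2r.
Unshelve. all: by end_near.
Qed.

#[local] Instance is_diff_lin_fun (a : obs A) (xi : Odual) :
  is_diff xi (lin_fun a : Odual -> R) (lin_fun a).
Proof.
apply: (@DiffDef R Odual R^o); last exact/diff_lin/continuous_lin_fun.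
exact/linear_differentiable/continuous_lin_fun.
Qed.

(** This is the quotient rule at a point where the denominator equals 1. *)
Lemma diff_expval (a : obs A) (rho xi : Odual) : rho (obs_one A) = 1 ->
  'd (expval a : Odual -> R) rho xi = xi a - rho a * xi (obs_one A).
Proof.
move=> rho1; have rhoI : lin_fun (obs_one A) rho = 1 by [].
have dI : differentiable (lin_fun (obs_one A) : Odual -> R) rho by [].
have nz : lin_fun (obs_one A) rho != 0 by rewrite rhoI oner_neq0.
have da : differentiable (lin_fun a : Odual -> R) rho by [].
have dlin b : 'd (lin_fun b : Odual -> R) rho xi = xi b.
  by have [_] := is_diff_lin_fun b rho => /(congr1 (@^~ xi)).
have dinv : 'd (fun y => (lin_fun (obs_one A) y)^-1) rho xi =
    - (lin_fun (obs_one A) rho ^- 2) * xi (obs_one A).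
  rewrite -(dlin (obs_one A)).
  exact: (congr1 (@^~ xi) (diffV dI nz)).
have dmul := congr1 (@^~ xi) (diffM da (differentiableV dI nz)).
transitivity (rho a * - (1 ^- 2) * xi (obs_one A) + 1^-1 * xi a); last first.
  by rewrite expr1n invr1; ring.
by rewrite [LHS]dmul -mulrA -{1 2}rhoI -dinv -(dlin a).
Qed.

(* Affine-plus-product functions are closed under directional derivatives, so
   smoothness follows by induction on the order. *)
Lemma smooth_on_quadratic (c : R) (a b d : obs A) (U : set Odual) :
  smooth_on U (fun xi => c + lin_fun a xi + lin_fun b xi * lin_fun d xi).
Proof.
pose q c a b d : Odual -> R := fun xi =>
  c + lin_fun a xi + lin_fun b xi * lin_fun d xi.
have qE r x y z : q r x y z = cst r + lin_fun x + lin_fun y * lin_fun z by [].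
have qdiff r x y z (xi : Odual) : is_diff xi (q r x y z)
    (0 + lin_fun x + (lin_fun y xi *: lin_fun z + lin_fun z xi *: lin_fun y)).
  rewrite qE; exact: is_diffD.
move=> k; rewrite -/(q c a b d); elim: k c a b d => [|k IHk] c a b d /=.
  move=> xi _; apply: differentiable_continuous.
  by have [] := qdiff c a b d xi.
split=> [xi _|v]; first by have [] := qdiff c a b d xi.
suff -> : 'D_v (q c a b d) = q (v a) (v b *: d + v d *: b) 0 0 by exact: IHk.
apply/funext => xi; have [dq vq] := qdiff c a b d xi.
rewrite (deriveE v dq) vq /q /lin_fun.
transitivity (0 + v a + (xi b * v d + xi d * v b)); first by [].
by rewrite !linear0 linearP linearZ /= /GRing.scale /=; ring.
Qed.

End Calculus.

(** * Covectors on the hyperplane and the observables that represent them *)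

Section Restriction.
Variables (R : realType) (A : cstarAlgType R).
Local Notation Odual := 'Hom(obs A, R^o).
Local Notation tangent := (subvs_of (hyperplane_tangent A)).

(** Precomposing with a fixed projection onto the hyperplane makes the extension linear in [alpha];
    its values off the hyperplane depend on the projection. *)
Definition extend_cov (alpha : states_cotangent A) : cotangent A :=
  (alpha \o linfun (vsproj (hyperplane_tangent A)))%VF.

Lemma extend_covP (alpha : states_cotangent A) (v : tangent) :
  extend_cov alpha (vsval v) = alpha v.
Proof. by rewrite comp_lfunE lfunE /= vsvalK. Qed.

(** The lift does not involve a state, so one observable represents [alpha] at every point. *)
Definition lift_obs (alpha : states_cotangent A) : obs A :=
  obs_of_cov (extend_cov alpha).

Lemma lift_obs_linear : linear lift_obs.
Proof.
move=> r alpha beta; rewrite /lift_obs /obs_of_cov -linearP; congr (_ _).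
apply/lfunP=> xi.
by rewrite add_lfunE scale_lfunE !comp_lfunE add_lfunE scale_lfunE.
Qed.

Lemma tangent1 (v : tangent) : vsval v (obs_one A) = 0.
Proof.
by have := subvsP v; rewrite memv_ker => /eqP; rewrite cov_of_obsE.
Qed.

Lemma lift_obsE (alpha : states_cotangent A) (v : tangent) :
  vsval v (lift_obs alpha) = alpha v.
Proof. by rewrite -cov_of_obsE obs_of_covK extend_covP. Qed.

Lemma states1 (rho : states A) : val rho (obs_one A) = 1.
Proof. by have /set_mem[] := valP rho. Qed.

Lemma differential_expval (a : obs A) (rho : states A) :
  differential (expval a) (val rho) =
  cov_of_obs A (a - val rho a *: obs_one A).
Proof.
have rho1 := states1 rho.
apply/lfunP => xi; rewrite lfunE /= diff_expval // cov_of_obsE.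
by rewrite [RHS]linearB [in RHS]linearZ.
Qed.

(** Tangent vectors vanish on the unit, which removes the centring term and with it the dependence
    on [rho]. *)
Lemma states_differentialE (a : obs A) (rho : states A) (v : tangent) :
  states_differential (expval a) rho v = vsval v a.
Proof.
have lin : linear (fun w : tangent =>
    differential (expval a) (val rho) (vsval w) : R^o).
  by move=> r u w; rewrite [vsval _]linearP linearP.
pose L := GRing.isLinear.Build R _ R^o *:%R _ lin.
pose l : {linear tangent -> R^o} :=
  HB.pack (fun w => differential (expval a) (val rho) (vsval w) : R^o) L.
rewrite -[LHS]/(linfun l v) lfunE /l /= differential_expval cov_of_obsE.
by rewrite linearB linearZ /= tangent1 scaler0 subr0.
Qed.

Lemma states_differential_lift (alpha : states_cotangent A) (rho : states A) :
  states_differential (expval (lift_obs alpha)) rho = alpha.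
Proof. by apply/lfunP => v; rewrite states_differentialE lift_obsE. Qed.

(** At each state the differentials of the [expval a] exhaust the covectors, so the prescribed
    values leave no freedom. *)
Lemma restricts_to_states_unique T TD TD' :
  @restricts_to_states R A T TD -> restricts_to_states T TD' -> TD = TD'.
Proof.
move=> [_ E] [_ E']; apply/funext => rho; apply/funext => alpha.
apply/funext => beta; rewrite -(states_differential_lift alpha rho).
by rewrite -(states_differential_lift beta rho) E E'.
Qed.

(* A covector on the hyperplane determines the observable only modulo the unit;
   subtracting the mean value at [rho] picks one representative. *)
Lemma states_differential_inj (a b : obs A) (rho : states A) :
  states_differential (expval a) rho = states_differential (expval b) rho ->
  a - val rho a *: obs_one A = b - val rho b *: obs_one A.
Proof.
have rho1 := states1 rho.
move=> eab; apply: (can_inj (@cov_of_obsK R A)); apply/lfunP => xi.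
(* Since [rho] takes the value 1 on the unit, subtracting this multiple projects [xi] onto the
   hyperplane along [rho]; testing there amounts to testing the centred observables on [xi]. *)
have mem : xi - xi (obs_one A) *: val rho \in hyperplane_tangent A.
  rewrite memv_ker cov_of_obsE add_lfunE opp_lfunE scale_lfunE rho1.
  by rewrite /GRing.scale /= mulr1 subrr.
have : vsval (Subvs mem : tangent) a = vsval (Subvs mem : tangent) b.
  by rewrite -!(states_differentialE _ rho) eab.
rewrite -[vsval _]/(xi - xi (obs_one A) *: val rho).
rewrite !add_lfunE !opp_lfunE !scale_lfunE !cov_of_obsE !linearB !linearZ /=.
by rewrite /GRing.scale /= !mulrN ![xi (obs_one A) * _]mulrC.
Qed.

End Restriction.

(** * Restriction of the tensor of an arbitrary bilinear product *)

Section ProductTensor.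
Variables (R : realType) (A : cstarAlgType R).
Local Notation Odual := 'Hom(obs A, R^o).

(** [Lambda_hat] and [Rtensor_hat] are, by conversion, the cases where [p] is [lie] and [jordan]. *)
Definition product_tensor (p : obs A -> obs A -> obs A)
    (zeta : Odual) (alpha beta : cotangent A) : R :=
  lin_fun (obs_one A) zeta * zeta (p (obs_of_cov alpha) (obs_of_cov beta)).

Variables (p : obs A -> obs A -> obs A) (c : R).
Hypothesis p_linearl : forall b, linear (p ^~ b).
Hypothesis p_linearr : forall a, linear (p a).
Hypothesis p1l : forall b, p (obs_one A) b = c *: b.
Hypothesis p1r : forall a, p a (obs_one A) = c *: a.

(** The subtracted term makes the value independent of the chosen lifts, which are determined only
    up to multiples of the unit. *)
Definition states_tensor (rho : states A) (alpha beta : states_cotangent A) : R :=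
  let a := lift_obs alpha in let b := lift_obs beta in
  val rho (p a b) - c * (val rho a * val rho b).

(** Expanding, the two mixed terms each contribute [- c * (rho a * rho b)] and the unit-unit term
    contributes it once with the opposite sign. *)
Lemma centred_product (a b : obs A) (rho : Odual) : rho (obs_one A) = 1 ->
  rho (p (a - rho a *: obs_one A) (b - rho b *: obs_one A)) =
  rho (p a b) - c * (rho a * rho b).
Proof.
move=> rho1; rewrite -!scaleNr ![_ + - _ *: _]addrC p_linearl !p_linearr.
rewrite !p1l !p1r !(linearP, linearZ) /= rho1 /GRing.scale /=.
by ring.
Qed.

Lemma product_tensorE (a b : obs A) (rho : states A) :
  product_tensor p (val rho) (differential (expval a) (val rho))
                             (differential (expval b) (val rho)) =
  val rho (p a b) - c * (val rho a * val rho b).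
Proof.
have rho1 := states1 rho.
rewrite /product_tensor !differential_expval !cov_of_obsK /lin_fun rho1 mul1r.
exact: centred_product.
Qed.

Lemma states_tensorE (a b : obs A) (rho : states A) :
  states_tensor rho (states_differential (expval a) rho)
                    (states_differential (expval b) rho) =
  val rho (p a b) - c * (val rho a * val rho b).
Proof.
have rho1 := states1 rho.
(* The lift of the differential of [expval d] may differ from [d], but both have the same centred
   observable at [rho]. *)
have centredE d := states_differential_inj
  (states_differential_lift (states_differential (expval d) rho) rho).
rewrite -[RHS](centred_product a b rho1) -(centredE a) -(centredE b).
exact/esym/(centred_product _ _ rho1).
Qed.

Lemma states_tensor_field : tensor_field_on_states states_tensor.
Proof.
split=> [rho alpha r beta gamma|rho beta r alpha gamma|alpha beta].
- rewrite /states_tensor lift_obs_linear p_linearr !linearP /= /GRing.scale /=.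
  by ring.
- rewrite /states_tensor lift_obs_linear p_linearl !linearP /= /GRing.scale /=.
  by ring.
(* The formula extends to a quadratic polynomial on the whole dual; [- c] is absorbed into an
   observable to fit [smooth_on_quadratic]. *)
exists setT, (fun xi => 0 + lin_fun (p (lift_obs alpha) (lift_obs beta)) xi +
  lin_fun (- c *: lift_obs alpha) xi * lin_fun (lift_obs beta) xi).
split=> [||| rho]; [exact: openT|by []|exact: smooth_on_quadratic|].
have lZ : val rho (- c *: lift_obs alpha) = - c * val rho (lift_obs alpha).
  exact: linearZ.
by rewrite /states_tensor /lin_fun lZ; ring.
Qed.

Lemma states_tensor_unique :
  unique (restricts_to_states (product_tensor p)) states_tensor.
Proof.
have restr : restricts_to_states (product_tensor p) states_tensor.
  split=> [|rho a b]; first exact: states_tensor_field.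
  by rewrite states_tensorE product_tensorE.
by split=> // TD; exact: restricts_to_states_unique.
Qed.

(** Both sides scale by the square of [s]: on the left through [f_I] and [zeta], on the right
    through the two pulled-back covectors. *)
Lemma product_tensor_dilation : dilation_invariant (product_tensor p).
Proof.
move=> s zeta alpha beta _ _; rewrite /product_tensor.
have covZ (g : cotangent A) : (g \o (s *: \1))%VF = s *: g.
  by apply/lfunP => xi; rewrite comp_lfunE !scale_lfunE id_lfunE linearZ.
(* Linearity at scalar -1 and zero vectors reads [p 0 b = - p 0 b + p 0 b]. *)
have p0l b : p 0 b = 0.
  by have := p_linearl b (-1) 0 0; rewrite scaler0 addr0 scaleN1r addNr.
have p0r a : p a 0 = 0.
  by have := p_linearr a (-1) 0 0; rewrite scaler0 addr0 scaleN1r addNr.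
have plZ b r a : p (r *: a) b = r *: p a b.
  by have := p_linearl b r a 0; rewrite p0l !addr0.
have prZ a r b : p a (r *: b) = r *: p a b.
  by have := p_linearr a r b 0; rewrite p0r !addr0.
rewrite !covZ /obs_of_cov !linearZ /= plZ prZ /lin_fun !scale_lfunE !linearZ /=.
by rewrite /GRing.scale /=; ring.
Qed.

End ProductTensor.

Theorem theorem2p16 (R : realType) (A : cstarAlgType R) :
  [/\ dilation_invariant (@Lambda_hat R A), dilation_invariant (@Rtensor_hat R A) &
      exists LambdaD RD : states A -> states_cotangent A -> states_cotangent A -> R,
        [/\ unique (restricts_to_states (@Lambda_hat R A)) LambdaD,
            unique (restricts_to_states (@Rtensor_hat R A)) RD &
            forall (rho : states A) (a b : obs A),
              LambdaD rho (states_differential (expval a) rho)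
                          (states_differential (expval b) rho)
                = expval (lie a b) (val rho) /\
              RD rho (states_differential (expval a) rho)
                     (states_differential (expval b) rho)
                = expval (jordan a b) (val rho)
                  - expval a (val rho) * expval b (val rho)]].
Proof.
have lie1l (b : obs A) : lie (obs_one A) b = 0 *: b by rewrite lie1 scale0r.
have lie1r (a : obs A) : lie a (obs_one A) = 0 *: a.
  by rewrite lieC lie1 oppr0 scale0r.
have jordan1l (b : obs A) : jordan (obs_one A) b = 1 *: b.
  by rewrite jordan1 scale1r.
have jordan1r (a : obs A) : jordan a (obs_one A) = 1 *: a.
  by rewrite jordanC jordan1 scale1r.
have expvalE (a : obs A) (rho : states A) : expval a (val rho) = val rho a.
  by rewrite /expval /lin_fun states1 divr1.
have lieL := @lie_linearl R A; have lieR := @lie_linearr R A.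
have jordanL := @jordan_linearl R A; have jordanR := @jordan_linearr R A.
split; first exact: product_tensor_dilation lieL lieR.
  exact: product_tensor_dilation jordanL jordanR.
exists (states_tensor (@lie R A) 0), (states_tensor (@jordan R A) 1); split.
- exact: states_tensor_unique lieL lieR lie1l lie1r.
- exact: states_tensor_unique jordanL jordanR jordan1l jordan1r.
move=> rho a b; rewrite !expvalE; split.
- by rewrite (states_tensorE lieL lieR lie1l lie1r) mul0r subr0.
- by rewrite (states_tensorE jordanL jordanR jordan1l jordan1r) mul1r.
Qed.
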